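(* Let $n\in\mathbb{N}_0$ and define $$y\left(n,\tfrac12\right)=\sum_{j=0}^{n}\frac{(-1)^{n}}{(j+1)\left(\tfrac12\right)^{j+1}\left(\tfrac12-1\right)^{n+1-j}}.$$ Then, writing $m=\lfloor n/2\rfloor$ (integer part), $$y\left(n,\tfrac12\right)=2^{n+2}\left(n\int_{0}^{1}(1-x)^{n-1}\ln(x)\,dx-m\int_{0}^{1}(1-x)^{m-1}\ln(x)\,dx\right)+\frac{(-1)^{n+1}2^{n+2}}{n+1}.$$
   Context: For $n=0$ or $m=0$ the corresponding term (a zero coefficient times the convergent integral $\int_0^1(1-x)^{-1}\ln x\,dx$) is $0$. *)

(* Defs.v *)
From mathcomp Require Import all_boot all_order all_algebra.
From mathcomp Require Import all_classical all_reals all_analysis.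

Set Implicit Arguments.
Unset Strict Implicit.
Unset Printing Implicit Defensive.

Import Order.TTheory GRing.Theory Num.Theory.
Import numFieldNormedType.Exports.

Local Open Scope ring_scope.

Definition y (R : realType) (n : nat) (lambda : R) : R :=
  \sum_(0 <= j < n.+1)
    (-1) ^+ n / (j.+1%:R * lambda ^+ j.+1 * (lambda - 1) ^+ (n.+1 - j)).

(* The integrand has constant sign on ]0, 1[, so the Lebesgue integral is the
   improper Riemann integral.  It is extended-real-valued, so that divergence
   would not be hidden by a finite default value.  The exponent k - 1 is an
   integer, equal to -1 when k = 0. *)
Definition log_integral (R : realType) (k : nat) : \bar R :=
  (\int[@lebesgue_measure R]_(x in `]0%R, 1%R[)
     ((1 - x) ^ (k%:Z - 1) * ln x)%R%:E)%E.

(* Main.v *)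
Require Import Defs.
From mathcomp Require Import all_boot all_order all_algebra.
From mathcomp Require Import all_classical all_reals all_analysis.
From mathcomp Require Import measurable_realfun ring lra.

Set Implicit Arguments.
Unset Strict Implicit.
Unset Printing Implicit Defensive.

Import Order.TTheory GRing.Theory Num.Theory.
Import numFieldNormedType.Exports.

Local Open Scope classical_set_scope.
Local Open Scope ring_scope.

(* For k > 0, the function
     ((1 - (1 - x)^k) ln x - \sum_(1 <= i <= k) (1 - (1 - x)^i) / i) / k
   is an antiderivative of (1 - x)^(k - 1) ln x; it tends to 0 at 0, so
   k \int_0^1 (1 - x)^(k - 1) ln x dx is minus the k-th harmonic number H_k.
   On the other side, y(n, 1/2) is -2^(n + 2) times the alternating harmonic
   sum of length n + 1, and the one of length n is H_n - H_(n/2). *)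

(** The intervals [[a + 1 / (k + 1), b]] exhaust []a, b]]. On each of them the usual fundamental
    theorem applies, and monotone convergence for a function of constant sign passes to the limit,
    even if [f] is unbounded near [a]. *)
Lemma le0_FTC2_itvoc (R : realType) (f F : R -> R) (a b l : R) :
  a < b ->
  {in `]a, b], forall x, f x <= 0} ->
  {in `]a, b], continuous f} ->
  (forall x, x \in `]a, b] -> is_derive x 1 F (f x)) ->
  (F x @[x --> a^'+] --> l)%classic ->
  (\int[@lebesgue_measure R]_(x in `]a, b]) (f x)%:E)%E = (F b - l)%:E.
Proof.
move=> ab f0 cf dF Fl.
pose c k : R := a + k.+1%:R^-1.
have ac k : a < c k by rewrite ltrDl invr_gt0.
have sub k x : x \in `[c k, b] -> x \in `]a, b].
  by rewrite !in_itv/= => /andP[ckx ->]; rewrite (lt_le_trans (ac k)).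
have cfk k : {within `[c k, b], continuous f}%classic.
  by apply: continuous_in_subspaceT => x /set_mem /sub; exact: cf.
rewrite itv_open_bnd_bigcup.
have intcvg :
    (\int[@lebesgue_measure R]_(x in `[c k, b]) (f x)%:E)%E @[k --> \oo] -->
    (\int[@lebesgue_measure R]_(x in \bigcup_k `[c k, b]%classic) (f x)%:E)%E.
  apply: le0_nondecreasing_set_cvg_integral => //.
  - move=> m n mn; rewrite subsetEset => x /=; rewrite !in_itv/= => /andP[cx ->].
    rewrite andbT (le_trans _ cx)// lerD2l lef_pV2 ?posrE//.
    by rewrite ler_nat.
  - move=> k; apply/measurable_EFinP.
    exact: subspace_continuous_measurable_fun.
  - by move=> k x /sub xab; rewrite lee_fin; exact: f0.
apply: (cvg_unique _ intcvg) => //.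
have cl : (c k @[k --> \oo] --> a)%classic.
  by rewrite -[X in _ --> X]addr0; apply: cvgD; [exact: cvg_cst|exact: cvg_harmonic].
apply: (@cvg_trans _ ((F b - F (c k))%:E @[k --> \oo])%classic); last first.
  apply: cvg_EFin; first exact: nearW.
  by apply: cvgB; [exact: cvg_cst|move/cvg_at_rightP : Fl; apply].
apply: near_eq_cvg; near=> k.
(* For small [k] the point [c k] may lie beyond [b], so the fundamental theorem is applied only
   eventually. *)
have cb : c k < b by near: k; exact: cvgr_lt cl _ ab.
rewrite (continuous_FTC2 (F := F) cb) -?EFinB//.
- have dFk x : x \in `[c k, b] -> derivable F x 1 by move=> /sub /dF[].
  have /(continuous_within_itvP _ cb)[_ Fc Fb] :
    {within `[c k, b], continuous F}%classic.
    exact: derivable_within_continuous.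
  by split=> // x xcb; apply: dFk; exact: subset_itv_oo_cc.
- move=> x xcb; rewrite derive1E; apply: derive_val; apply: dF.
  by apply: (sub k); exact: subset_itv_oo_cc.
Unshelve. all: by end_near. Qed.

(* The lower bound comes from ln x = 2 ln (sqrt x) and ln t < t at
   t = 1 / sqrt x. *)
Lemma cvg_mulr_ln_at_right0 (R : realType) :
  (x * ln x @[x --> (0 : R)^'+] --> (0 : R))%classic.
Proof.
apply: (@squeeze_cvgr _ _ _ _ (fun x : R => - (2 * Num.sqrt x)) (cst 0)).
- near=> x.
  have x0 : 0 < x by near: x; exact: nbhs_right_gt.
  have x1 : x < 1 by near: x; exact: nbhs_right_lt.
  rewrite nmulr_lle0 ?ln_lt0 ?x0//=.
  set s := Num.sqrt x.
  have s0 : 0 < s by rewrite sqrtr_gt0.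
  have -> : x = s ^+ 2 by rewrite sqr_sqrtr// ltW.
  rewrite lnXn// sqr_ge0 andbT.
  have : ln s^-1 < s^-1 by apply: ln_sublinear; rewrite invr_gt0.
  rewrite lnV ?posrE// => lns.
  have : - (ln s * s) < 1 by rewrite -mulNr -ltr_pdivlMr// div1r.
  nra.
- have : - (2 * Num.sqrt x) @[x --> (0 : R)^'+] --> - (2 * Num.sqrt (0 : R)).
    apply: cvgN; apply: cvgMr; apply: cvg_at_right_filter.
    exact: sqrt_continuous.
  by rewrite sqrtr0 mulr0 oppr0.
- exact: cvg_cst.
Unshelve. all: by end_near. Qed.

Lemma log_integralS (R : realType) (k : nat) :
  log_integral R k.+1 =
  (- (k.+1%:R^-1 * \sum_(0 <= i < k.+1) i.+1%:R^-1))%:E.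
Proof.
pose P : {poly R} := \sum_(i < k.+1) (1 - 'X) ^+ i.
pose A : {poly R} := 1 - (1 - 'X) ^+ k.+1.
pose Q : {poly R} := \sum_(i < k.+1) i.+1%:R^-1 *: (1 - (1 - 'X) ^+ i.+1).
have AE : A = 'X * P.
  by rewrite /A -opprB subrX1 addrAC subrr add0r mulNr opprK.
have dpow i : (1 - (1 - 'X : {poly R}) ^+ i.+1)^`() = i.+1%:R *: (1 - 'X) ^+ i.
  rewrite derivB deriv_exp !poly.derivE/= sub0r sub0r mulN1r mulNrn opprK.
  by rewrite scaler_nat.
have dQ : Q^`() = P.
  rewrite /Q linear_sum/=; apply: eq_bigr => i _.
  by rewrite derivZ dpow scalerA mulVf// scale1r.
pose f (x : R) := (1 - x) ^+ k * ln x.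
pose F (x : R) := k.+1%:R^-1 * (A.[x] * ln x - Q.[x]).
have lnc (x : R) : 0 < x -> {for x, continuous f}.
  move=> x0; apply: continuousM; last exact: continuous_ln.
  have -> : (fun x : R => (1 - x) ^+ k) = horner ((1 - 'X) ^+ k).
    by apply/funext => z; rewrite !hornerE.
  exact: continuous_horner.
have dF (x : R) : 0 < x -> is_derive x 1 F (f x).
  move=> x0.
  have := is_deriveZ k.+1%:R^-1 (is_deriveB
    (is_deriveM (is_derive_poly A x) (is_derive1_ln x0)) (is_derive_poly Q x)).
  move/is_derive_eq; apply.
  rewrite dQ dpow AE !hornerE /f; rewrite /GRing.scale/=.
  by field; rewrite ?gt_eqF//.
have F1 : F 1 = - (k.+1%:R^-1 * \sum_(0 <= i < k.+1) i.+1%:R^-1).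
  rewrite /F ln1 mulr0 sub0r mulrN; congr (- (_ * _)).
  rewrite /Q horner_sum big_mkord; apply: eq_bigr => i _.
  by rewrite !hornerE subrr expr0n subr0 mulr1.
have Fl : (F x @[x --> (0 : R)^'+] --> (0 : R))%classic.
  have Q0 : Q.[0] = 0.
    rewrite /Q horner_sum big1// => i _.
    by rewrite !hornerE subr0 expr1n subrr mulr0.
  have -> : F = fun x => k.+1%:R^-1 * ((x * ln x) * P.[x] - Q.[x]).
    by apply/funext => x; rewrite /F AE !hornerE mulrAC.
  have : k.+1%:R^-1 * ((x * ln x) * P.[x] - Q.[x]) @[x --> (0 : R)^'+] -->
      k.+1%:R^-1 * (0 * P.[0] - Q.[0]).
    apply: cvgMr; apply: cvgB; last first.
      by apply: cvg_at_right_filter; exact: continuous_horner.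
    apply: cvgM; first exact: cvg_mulr_ln_at_right0.
    by apply: cvg_at_right_filter; exact: continuous_horner.
  by rewrite Q0 mul0r subr0 mulr0.
rewrite -F1 -[F 1]subr0 -(le0_FTC2_itvoc (f := f) ltr01 _ _ _ Fl).
(* Adding the endpoint 1, a null set, turns the open interval into []0, 1]]. *)
- rewrite /log_integral integral_itv_bndo_bndc; last first.
    apply/measurable_EFinP; apply: open_continuous_measurable_fun => //.
    move=> x /set_mem/=; rewrite in_itv/= => /andP[x0 _].
    rewrite -addn1 PoszD addrK; exact: lnc.
  by apply: eq_integral => x _; rewrite -addn1 PoszD addrK.
- move=> x; rewrite in_itv/= => /andP[x0 x1].
  by rewrite mulr_ge0_le0// ?ln_le0// exprn_ge0// subr_ge0.
- by move=> x; rewrite in_itv/= => /andP[x0 _]; exact: lnc.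
- by move=> x; rewrite in_itv/= => /andP[x0 _]; exact: dF.
Qed.

Lemma natr_mul_log_integral (R : realType) (n : nat) :
  (n%:R%:E * log_integral R n = (- \sum_(0 <= i < n) i.+1%:R^-1)%:E)%E.
Proof.
(* For [n = 0], the product by 0 in the extended reals is 0, which is the empty sum. *)
case: n => [|k]; first by rewrite mul0e big_geq// oppr0.
by rewrite log_integralS -EFinM mulrN mulrA divff// mul1r.
Qed.

Lemma alternating_harmonic (F : numFieldType) (n : nat) :
  \sum_(0 <= i < n) (-1) ^+ i / i.+1%:R =
  \sum_(0 <= i < n) i.+1%:R^-1 - \sum_(0 <= i < n./2) i.+1%:R^-1 :> F.
Proof.
elim: n => [|n IHn]; first by rewrite !big_geq// subr0.
rewrite !big_nat_recr//= IHn uphalf_half -signr_odd.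
(* The half-length sum grows only when [n] is odd. Its new term is then [2 / (n + 1)], which turns
   [1 / (n + 1)] into [- 1 / (n + 1)]. *)
case: (boolP (odd n)) => on; last by rewrite add0n expr0 mul1r addrAC.
have n2 : n.+1%:R = 2 * n./2.+1%:R :> F.
  by rewrite -natrM mul2n -[in LHS](odd_double_half n) on doubleS.
rewrite add1n big_nat_recr//= n2 expr1; field.
by rewrite addrC natr1 pnatr_eq0.
Qed.

(** At 1/2 the two bases are opposite, so the powers in each denominator merge into [2^-(n + 2)],
    and the signs combine to [(-1)^(j + 1)]. *)
Lemma y_half (R : realType) (n : nat) :
  y n (2^-1 : R) =
  - (2 ^+ n.+2 * \sum_(0 <= j < n.+1) (-1) ^+ j / j.+1%:R).
Proof.
rewrite /y mulr_sumr -sumrN; apply: eq_big_nat => j /andP[_ jn].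
have -> : 2^-1 - 1 = - 2^-1 :> R by field.
(* Writing [n = j + i] removes the truncated subtraction from the exponent. *)
have [i ni] : exists i, n = (j + i)%N by exists (n - j)%N; rewrite subnKC.
rewrite ni -addnS addKn [(- 2^-1) ^+ _]exprNn !exprVn !(exprS, exprD).
by field; rewrite addrC natr1 !pnatr_eq0 signr_eq0 !expf_neq0 ?pnatr_eq0.
Qed.

Theorem theorem7 (R : realType) (n : nat) :
  let m := n./2 in
  (y n (2^-1 : R))%:E =
  ((2 ^+ n.+2)%R%:E *
     (n%:R%:E * log_integral R n - m%:R%:E * log_integral R m) +
   ((-1) ^+ n.+1 * 2 ^+ n.+2 / n.+1%:R)%R%:E)%E.
Proof.
rewrite /= !natr_mul_log_integral -EFinB -EFinM -EFinD y_half.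
(* The term [j = n] is split off and becomes the last summand of the formula; the remaining sum has
   length [n], whence the half [n./2]. *)
rewrite big_nat_recr//= alternating_harmonic; congr EFin.
by rewrite !exprS; ring.
Qed.
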